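(* Let $\kappa$ be a field, let $S(\mathbf R;\kappa)$ be the full Hahn field with coefficients in $\kappa$ and value group $\mathbf R$, and let $V_H$ be its valuation ring. Then $V_H$ is non-Noetherian and $V_H[[T]]$ is a coherent GCD domain. In particular, there exists a non-Noetherian valuation domain $V$ such that $V[[T]]$ is a GCD domain.
   Context: The full Hahn field $S(\mathbf R;\kappa)$ consists of all formal sums $\sum_{\gamma\in\mathbf R}c_\gamma t^\gamma$ with $c_\gamma\in\kappa$ whose support $\{\gamma\mid c_\gamma\ne 0\}$ is a well-ordered subset of $\mathbf R$, with the usual addition and convolution product, and with valuation $v$ sending a nonzero element to the minimum of its support; its valuation ring is the set of elements with support in $[0,\infty)$. A ring is coherent if every finitely generated ideal is finitely presented. A GCD domain is an integral domain in which every pair of nonzero elements has a greatest common divisor. *)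

(* Defs.v *)
From HB Require Import structures.
From mathcomp Require Import all_boot all_order all_algebra.
From mathcomp Require Import all_classical all_reals wochoice.

Set Implicit Arguments.
Unset Strict Implicit.
Unset Printing Implicit Defensive.

Import Order.TTheory GRing.Theory Num.Theory.
Local Open Scope classical_set_scope.
Local Open Scope ring_scope.

Section Ideals.
Variable A : comNzRingType.
Implicit Types (a b d : A) (I : set A).

Definition divides a b := exists c, b = c * a.

Definition is_ideal I :=
  [/\ I 0, forall x y, I x -> I y -> I (x + y) & forall a x, I x -> I (a * x)].

(* The ideal generated by the entries of the column s. *)
Definition ideal_gen n (s : 'cV[A]_n) : set A :=
  [set (c *m s) 0 0 | c in [set: 'rV[A]_n]].

Definition finitely_generated I := exists n (s : 'cV[A]_n), I = ideal_gen s.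

(* Exactness of A^m --k--> A^n --s--> I --> 0, with A^m and A^n free modules *)
(* of row vectors; every A-linear map from A^n to I is of the form c |-> c s. *)
Definition finitely_presented I :=
  exists n (s : 'cV[A]_n), I = ideal_gen s /\
    exists m (k : 'M[A]_(m, n)),
      [set c : 'rV[A]_n | c *m s = 0] = [set d *m k | d in [set: 'rV[A]_m]].

Definition noetherian := forall I, is_ideal I -> finitely_generated I.

Definition coherent :=
  forall I, finitely_generated I -> finitely_presented I.

Definition is_gcd a b d :=
  [/\ divides d a, divides d b &
      forall e, divides e a -> divides e b -> divides e d].

Definition gcd_domain := GRing.integral_domain_axiom A /\
  forall a b, a != 0 -> b != 0 -> exists d, is_gcd a b d.

Definition valuation_domain := GRing.integral_domain_axiom A /\
  forall a b, divides a b \/ divides b a.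

End Ideals.

Arguments noetherian : clear implicits.
Arguments coherent : clear implicits.
Arguments gcd_domain : clear implicits.
Arguments valuation_domain : clear implicits.

(* Formal power series A[[T]], as coefficient sequences. This is a record so *)
(* that it does not inherit the pointwise product of [nat -> A]. *)
Record powser (A : comNzRingType) := PowSer { pscoef :> nat -> A }.

HB.instance Definition _ (A : comNzRingType) := [isNew for @pscoef A].
HB.instance Definition _ (A : comNzRingType) := [Choice of powser A by <:].

Section PowSerRing.
Variable A : comNzRingType.
Implicit Types a b c : powser A.

Lemma powserP a b : (forall n, a n = b n) -> a = b.
Proof. by move=> ab; apply: val_inj; apply/funext. Qed.

Definition psadd a b := PowSer (fun n => a n + b n).
Definition psopp a := PowSer (fun n => - a n).
Definition psmul a b := PowSer (fun n => \sum_(i < n.+1) a i * b (n - i)%N).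
Definition psone : powser A := PowSer (fun n => (n == 0)%:R).

Fact psaddA : associative psadd.
Proof. by move=> a b c; apply: powserP => n /=; rewrite addrA. Qed.
Fact psaddC : commutative psadd.
Proof. by move=> a b; apply: powserP => n /=; rewrite addrC. Qed.
Fact psadd0 : left_id (PowSer (fun=> 0)) psadd.
Proof. by move=> a; apply: powserP => n /=; rewrite add0r. Qed.
Fact psaddN : left_inverse (PowSer (fun=> 0)) psopp psadd.
Proof. by move=> a; apply: powserP => n /=; rewrite addNr. Qed.

HB.instance Definition _ :=
  GRing.isZmodule.Build (powser A) psaddA psaddC psadd0 psaddN.

Definition pstrunc N a : {poly A} := \poly_(i < N) a i.

Lemma psmulE a b N n : (n < N)%N -> psmul a b n = (pstrunc N a * pstrunc N b)`_n.
Proof.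
move=> nN; rewrite coefM; apply: eq_bigr => i _.
by rewrite !coef_poly !(leq_ltn_trans _ nN)// ?leq_subr// -ltnS.
Qed.

Fact psmulC : commutative psmul.
Proof. by move=> a b; apply: powserP => n; rewrite !(psmulE _ _ (ltnSn n)) mulrC. Qed.

Lemma psmulEA a b c n :
  psmul (psmul a b) c n = (pstrunc n.+1 a * pstrunc n.+1 b * pstrunc n.+1 c)`_n.
Proof.
rewrite coefM; apply: eq_bigr => i _.
have iN : (i < n.+1)%N by [].
by rewrite -(psmulE a b iN) coef_poly ltnS leq_subr.
Qed.

Fact psmulA : associative psmul.
Proof.
move=> a b c; apply: powserP => n.
by rewrite [psmul a _]psmulC !psmulEA (mulrC _ (pstrunc n.+1 a)) mulrA.
Qed.

Fact psmul1 : left_id psone psmul.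
Proof.
move=> a; apply: powserP => n /=.
rewrite big_ord_recl/= mul1r subn0 big1 ?addr0// => i _.
by rewrite mul0r.
Qed.

Fact psmulDl : left_distributive psmul psadd.
Proof.
move=> a b c; apply: powserP => n /=.
by rewrite -big_split; apply: eq_bigr => i _; rewrite mulrDl.
Qed.

Fact psone_neq0 : psone != 0.
Proof. by apply/eqP => /(congr1 (fun a : powser A => a 0%N))/eqP; rewrite /= oner_eq0. Qed.

HB.instance Definition _ := GRing.Zmodule_isComNzRing.Build (powser A)
  psmulA psmulC psmul1 psmulDl psone_neq0.

End PowSerRing.

Section WellOrderedSets.
Variable R : realType.
Implicit Types (A S T : set R) (C : {pred R}) (g : R).

Definition has_minima S :=
  forall A, A `<=` S -> A !=set0 -> exists2 m, A m & forall a, A a -> m <= a.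

Lemma wo_chainP C : wo_chain <=%R C <-> has_minima [set g | g \in C].
Proof.
split=> [wC A AC [a Aa]|wC].
  have [||m [[/set_mem Am minm] _]] := wC (mem A).
  - by move=> g /set_mem/AC.
  - by exists a; apply/mem_set.
  by exists m => // b Ab; apply: minm; apply/mem_set.
apply: antisymmetric_wo_chain => [x y _ _|D DC [d Dd]]; first exact: le_anti.
have [|| m Dm minm] := wC [set g | g \in D]; [by move=> g /DC|by exists d|].
by exists m; split=> // a; apply: minm.
Qed.

Lemma has_minimaS S T : has_minima T -> S `<=` T -> has_minima S.
Proof. by move=> mT ST A AS; apply: mT; apply: subset_trans ST. Qed.

Lemma has_minima1 g : has_minima [set g].
Proof.
move=> A Ag [a Aa]; exists a => // b Ab.
by rewrite (Ag _ Aa) (Ag _ Ab).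
Qed.

Lemma has_minimaU S T : has_minima S -> has_minima T -> has_minima (S `|` T).
Proof.
move=> mS mT A AST A0.
have [AS|AS] := pselect ((A `&` S) !=set0); last first.
  apply: mT => // a Aa; have [Sa|//] := AST _ Aa.
  by case: AS; exists a.
have [AT|AT] := pselect ((A `&` T) !=set0); last first.
  apply: mS => // a Aa; have [//|Ta] := AST _ Aa.
  by case: AT; exists a.
have [m [Am Sm] minm] := mS _ (@subIsetr _ A S) AS.
have [n [An Tn] minn] := mT _ (@subIsetr _ A T) AT.
exists (Num.min m n); first by rewrite minEle; case: ifP.
move=> a Aa; rewrite ge_min; apply/orP.
by have [Sa|Ta] := AST _ Aa; [left; apply: minm|right; apply: minn].
Qed.

Lemma has_minimaD S T : has_minima S -> has_minima T ->
  has_minima [set g | exists a b, [/\ S a, T b & g = a + b]].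
Proof.
move=> mS mT A AST [g Ag].
pose SA := [set a | S a /\ exists b, T b /\ A (a + b)].
have [||a0 [Sa0 [b0 [Tb0 A0]]] mina0] := mS SA; first by move=> a [].
  by have [a [b [Sa Tb gE]]] := AST _ Ag; exists a; split=> //; exists b; rewrite -gE.
pose Rec := [set b | T b /\ exists a, [/\ S a, A (a + b) &
  forall a' b', S a' -> T b' -> a' < a -> A (a' + b') -> a + b < a' + b']].
have [||b1 [Tb1 [a1 [Sa1 A1 rec1]]] minb1] := mT Rec; first by move=> b [].
  exists b0; split=> //; exists a0; split=> // a' b' Sa' Tb' a'a0 A'.
  suff : a0 <= a' by rewrite leNgt a'a0.
  by apply: mina0; split=> //; exists b'.
exists (a1 + b1) => // x Ax; rewrite leNgt; apply/negP => xlt.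
pose L := [set a | S a /\ exists b, [/\ T b, A (a + b) & a + b < a1 + b1]].
have [||a2 [Sa2 [b2 [Tb2 A2 lt2]]] mina2] := mS L; first by move=> a [].
  by have [a [b [Sa Tb xE]]] := AST _ Ax; exists a; split=> //; exists b; rewrite -xE.
have a12 : a1 <= a2.
  rewrite leNgt; apply/negP => a21.
  by have := rec1 _ _ Sa2 Tb2 a21 A2; rewrite ltNge ltW.
have b21 : b2 < b1 by rewrite -(ltrD2l a2) (lt_le_trans lt2)// lerD2r.
suff : b1 <= b2 by rewrite leNgt b21.
apply: minb1; split=> //; exists a2; split=> // a' b' Sa' Tb' a'2 A'.
rewrite ltNge; apply/negP => le2.
suff : a2 <= a' by rewrite leNgt a'2.
by apply: mina2; split=> //; exists b'; split=> //; apply: le_lt_trans lt2.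
Qed.

Lemma has_minima_finite S T g : has_minima S -> has_minima T ->
  finite_set [set a | S a /\ T (g - a)].
Proof.
move=> mS mT; set A := [set a | _].
have minA B : B `<=` A -> B !=set0 -> exists2 m, B m & forall a, B a -> m <= a.
  by move=> BA; apply: mS => a /BA[].
have maxA B : B `<=` A -> B !=set0 -> exists2 m, B m & forall a, B a -> a <= m.
  move=> BA [b Bb]; have [|| _ [m Bm <-] minm] := mT [set g - a | a in B].
  - by move=> _ [a /BA[_ Ta] <-].
  - by exists (g - b), b.
  exists m => // a Ba; rewrite -(lerN2 m) -(lerD2l g).
  by apply: minm; exists a.
have [->//|/set0P A0] := eqVneq A set0.
pose hlow a := A `&` [set x | x <= a].
pose B := [set a | A a /\ finite_set (hlow a)].
have [||m [Am finm] maxm] := maxA B; first by move=> a [].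
  have [a Aa mina] := minA _ (@subset_refl _ A) A0.
  exists a; split=> //; apply: (sub_finite_set _ (finite_set1 a)) => x [Ax /= xa].
  by apply/eqP; rewrite eq_le xa mina.
apply: (sub_finite_set _ finm) => x Ax; split=> //=.
rewrite leNgt; apply/negP => mx.
have [||n [An mn] minn] := minA (A `&` [set x | m < x]); first by move=> a [].
  by exists x.
suff : n <= m by rewrite leNgt mn.
apply: maxm; split=> //.
apply: (@sub_finite_set _ _ (hlow m `|` [set n])).
  move=> y [Ay /= yn]; have [ym|my] := leP y m; first by left.
  by right; apply/eqP; rewrite eq_le yn minn.
by rewrite finite_setU; split=> //; apply: finite_set1.
Qed.

End WellOrderedSets.

Arguments has_minima1 {R} g.
Arguments has_minimaS {R S T}.
Arguments has_minimaU {R S T}.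
Arguments has_minimaD {R S T}.

Section Hahn.
Variables (R : realType) (kappa : fieldType).

Definition well_supported : pred (R -> kappa) :=
  fun f => `[< wo_chain <=%R (support f) >].

(* The full Hahn field S(R; kappa), as coefficient functions. *)
Record hahn := Hahn { hcoef :> R -> kappa; _ : well_supported hcoef }.

HB.instance Definition _ := [isSub for hcoef].
HB.instance Definition _ := [Choice of hahn by <:].

Definition hsupp (f : R -> kappa) := [set g | f g != 0].

Lemma well_supportedP f : reflect (has_minima (hsupp f)) (well_supported f).
Proof. exact: (equivP (asboolP _) (wo_chainP _)). Qed.

Fact well_supported_zmod : zmod_closed well_supported.
Proof.
split=> [|f h]; first by apply/well_supportedP => A A0 [a /A0]; rewrite /hsupp/= eqxx.
move=> /well_supportedP wf /well_supportedP wh; apply/well_supportedP.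
apply: (has_minimaS (has_minimaU wf wh)) => g; rewrite /hsupp/= => fhg.
apply/orP; rewrite -negb_and; apply: contra fhg => /andP[/eqP fg /eqP hg].
by rewrite !fctE fg hg subrr.
Qed.
HB.instance Definition _ :=
  GRing.isZmodClosed.Build (R -> kappa) well_supported well_supported_zmod.
HB.instance Definition _ := [SubChoice_isSubZmodule of hahn by <:].

Implicit Types x y z : hahn.

Lemma hahnP x y : (forall g, x g = y g) -> x = y.
Proof. by move=> xy; apply: val_inj; apply/funext. Qed.

Lemma hahn_minima x : has_minima (hsupp x).
Proof. by apply/well_supportedP/(valP x). Qed.
Arguments hahn_minima : clear implicits.

(* Only finitely many terms of this sum are nonzero, by [hahn_finite]. *)
Definition hconv (f h : R -> kappa) (g : R) : kappa :=
  \sum_(a \in [set: R]) f a * h (g - a).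

Lemma hconv_supp f h g (F : set R) :
    (forall a, f a != 0 -> h (g - a) != 0 -> F a) ->
  hconv f h g = \sum_(a \in F) f a * h (g - a).
Proof.
move=> sF; apply/esym/fsbig_widen => // a [_ /= nFa].
apply/eqP; apply: contra_notT nFa; rewrite mulf_eq0 negb_or => /andP[].
exact: sF.
Qed.

Lemma hahn_finite x y g : finite_set [set a | x a != 0 /\ y (g - a) != 0].
Proof. exact: (@has_minima_finite R _ _ g (hahn_minima x) (hahn_minima y)). Qed.

Lemma hconv_neq0 f h g : hconv f h g != 0 -> exists2 a, f a != 0 & h (g - a) != 0.
Proof.
move/eqP; apply: contra_notP => nex; rewrite /hconv fsbig1// => a _.
apply/eqP; apply: contra_notT nex; rewrite mulf_eq0 negb_or => /andP[fa ha].
by exists a.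
Qed.

Fact hconv_wf x y : well_supported (hconv x y).
Proof.
apply/well_supportedP.
apply: (has_minimaS (has_minimaD (hahn_minima x) (hahn_minima y))) => g.
move=> /hconv_neq0[a xa ya]; exists a, (g - a); split=> //.
by rewrite addrC subrK.
Qed.

Definition hmul x y := Hahn (hconv_wf x y).

(* The monomial c t^a. *)
Definition monomial_fun (c : kappa) (a g : R) : kappa := if g == a then c else 0.

Fact monomial_wf c a : well_supported (monomial_fun c a).
Proof.
apply/well_supportedP; apply: (has_minimaS (has_minima1 a)) => g.
by rewrite /hsupp/= /monomial_fun; have [//|_] := eqVneq g a; rewrite eqxx.
Qed.

Definition hmonomial c a := Hahn (monomial_wf c a).

Lemma hmonomialM c a x g : hmul (hmonomial c a) x g = c * x (g - a).
Proof.
rewrite /hmul/= (@hconv_supp _ _ _ [set a]) ?fsbig_set1 /monomial_fun ?eqxx//.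
by move=> b; have [//|_] := eqVneq b a; rewrite eqxx.
Qed.

Definition hone := hmonomial 1 0.

Fact hmulC : commutative hmul.
Proof.
move=> x y; apply: hahnP => g /=; rewrite /hconv.
rewrite (@reindex_fsbigT _ _ _ _ _ (fun a => g - a)) /=; last first.
  by exists (fun a => g - a) => a; rewrite subKr.
by apply: eq_fsbigr => a _; rewrite subKr mulrC.
Qed.

Fact hmul1 : left_id hone hmul.
Proof. by move=> x; apply: hahnP => g; rewrite hmonomialM mul1r subr0. Qed.

Fact hmulDl : left_distributive hmul +%R.
Proof.
move=> x y z; apply: hahnP => g /=.
pose F := [set a | x a != 0 /\ z (g - a) != 0] `|`
          [set a | y a != 0 /\ z (g - a) != 0].
have finF : finite_set F by rewrite finite_setU; split; apply: hahn_finite.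
rewrite /= -[RHS]/(hconv x z g + hconv y z g) !(@hconv_supp _ _ _ F); first last.
- move=> a /= xya za; have {}xya : x a + y a != 0 := xya.
  have [x0|x0] := eqVneq (x a) 0; last by left.
  by right; split=> //; move: xya; rewrite x0 add0r.
- by move=> a xa za; left.
- by move=> a ya za; right.
rewrite -fsbig_split//; apply: eq_fsbigr => a _.
exact: mulrDl.
Qed.

Fact hmulA : associative hmul.
Proof.
move=> x y z; apply: hahnP => g /=.
pose F := [set a | x a != 0 /\
  [set g' | exists b c, [/\ y b != 0, z c != 0 & g' = b + c]] (g - a)].
have finF : finite_set F.
  apply: (@has_minima_finite _ _ _ _ (hahn_minima x)).
  exact: has_minimaD (hahn_minima y) (hahn_minima z).
pose C := \bigcup_(a in F)
  [set a + b | b in [set b | y b != 0 /\ z (g - a - b) != 0]].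
have finC : finite_set C.
  by apply: bigcup_finite => // a _; apply/finite_image/hahn_finite.
have FC a c : x a != 0 -> y (c - a) != 0 -> z (g - c) != 0 -> F a /\ C c.
  move=> xa ya zc.
  have Fa : F a.
    by split=> //; exists (c - a), (g - c); split=> //; rewrite [RHS]addrC subrKA.
  split=> //; exists a => //; exists (c - a); last by rewrite addrC subrK.
  by split=> //; rewrite opprB subrKA.
transitivity (\sum_(a \in F) \sum_(c \in C) x a * (y (c - a) * z (g - c))).
  rewrite (@hconv_supp _ _ _ F); last first.
    move=> a xa /hconv_neq0[b yb zb]; split=> //.
    by exists b, (g - a - b); split=> //; rewrite [RHS]addrC subrK.
  apply: eq_fsbigr => a /set_mem[xa _]; rewrite -fsbig_distrr//; congr (_ * _).
  rewrite /= /hconv (@reindex_fsbigT _ _ _ _ _ (fun c => c - a))/=; last first.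
    by exists (fun b => b + a) => b; rewrite ?subrK ?addrK.
  rewrite [RHS](@fsbig_widen _ _ _ _ _ [set: R])//.
    by apply: eq_fsbigr => c _; rewrite opprB subrKA.
  move=> c [_ /= nC]; apply/eqP; apply: contra_notT nC.
  by rewrite mulf_eq0 negb_or => /andP[yc zc]; have [] := FC a c xa yc zc.
rewrite exchange_fsbig// (@hconv_supp _ _ _ C); last first.
  by move=> c /hconv_neq0[a xa yc] zc; have [] := FC a c xa yc zc.
apply: eq_fsbigr => c _; have [->|zc] := eqVneq (z (g - c)) 0.
  by rewrite mulr0 fsbig1// => a _; rewrite !mulr0.
rewrite /= (@hconv_supp _ _ _ F); last by move=> a xa yc; have [] := FC a c xa yc zc.
by rewrite mulrC fsbig_distrr//; apply: eq_fsbigr => a _; rewrite mulrA mulrC.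
Qed.

Fact hone_neq0 : hone != 0.
Proof.
apply/eqP => /(congr1 (fun x : hahn => x 0))/eqP.
by rewrite /hone/=/monomial_fun eqxx oner_eq0.
Qed.

HB.instance Definition _ := GRing.Zmodule_isComNzRing.Build hahn
  hmulA hmulC hmul1 hmulDl hone_neq0.

Lemma coef_hahn0 g : (0 : hahn) g = 0.
Proof. by []. Qed.

Lemma coef_hahnB x y g : (x - y) g = x g - y g.
Proof. by []. Qed.

Lemma coef_hahnD x y g : (x + y) g = x g + y g.
Proof. by []. Qed.

Lemma coef_hahn1 g : (1 : hahn) g = if g == 0 then 1 else 0.
Proof. by []. Qed.

Lemma coef_hahnM x y g : (x * y) g = hconv x y g.
Proof. by []. Qed.

Definition hlow x (s : R) := forall g, g < s -> x g = 0.

Lemma hlowM x y s t : hlow x s -> hlow y t -> hlow (x * y) (s + t).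
Proof.
move=> xs yt g gst; apply/eqP; apply: contraTT gst => /hconv_neq0[a xa ya].
have sa : s <= a by rewrite leNgt; apply: contra xa => /xs->.
have tga : t <= g - a by rewrite leNgt; apply: contra ya => /yt->.
by rewrite -leNgt -[g](subrK a) addrC lerD.
Qed.

Lemma hlowX x s n : hlow x s -> hlow (x ^+ n) (s *+ n).
Proof.
move=> xs; elim: n => [|n IH]; last by rewrite exprS mulrS; apply: hlowM.
by move=> g; rewrite expr0 mulr0n coef_hahn1 => /lt_eqF->.
Qed.

Lemma hlow_sub_inv e s : 0 < s -> hlow e s -> exists y, y * (1 - e) = 1.
Proof.
move=> s0 es; pose Y n : hahn := \sum_(i < n) e ^+ i.
have [N sN] : exists N : R -> nat, forall g, g < s *+ N g.
  exists (fun g => Num.bound (g / s)) => g.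
  have [g0|g0] := leP 0 g; last by rewrite (lt_le_trans g0)// mulrn_wge0 // ltW.
  rewrite -mulr_natl -ltr_pdivrMr// archi_boundP// divr_ge0// ltW//.
have YS n : Y n.+1 = Y n + e ^+ n by rewrite /Y big_ord_recr.
have YD n g k : g < s *+ n -> Y (n + k)%N g = Y n g.
  move=> gn; elim: k => [|k IH]; first by rewrite addn0.
  rewrite addnS YS coef_hahnD IH.
  rewrite (@hlowX e s (n + k)%N es g) ?addr0//.
  by rewrite (lt_le_trans gn)// mulrnDr lerDl mulrn_wge0// ltW.
have YE n m g : g < s *+ n -> g < s *+ m -> Y n g = Y m g.
  by move=> gn gm; rewrite -(YD n g m)// addnC YD.
have Yle g a : a <= g -> Y (N a) a = Y (N g) a.
  by move=> ag; apply: YE => //; apply: le_lt_trans ag (sN g).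
have yP : well_supported (fun g => Y (N g) g).
  apply/well_supportedP => A AY [g Ag].
  have [||m [Am mg] minm] := @hahn_minima (Y (N g)) (A `&` [set a | a <= g]).
  - by move=> a [/AY + /= ag]; rewrite /hsupp/= -(Yle g a ag).
  - by exists g; split=> /=.
  exists m => // a Aa; have [ag|/ltW ga] := leP a g; first by apply: minm.
  exact: le_trans ga.
exists (Hahn yP); apply: hahnP => g.
transitivity ((Y (N g) * (1 - e)) g).
  rewrite !coef_hahnM /hconv; apply: eq_fsbigr => a _.
  rewrite -[Hahn yP a]/(Y (N a) a).
  have [ag|ga] := leP a g; first by rewrite (Yle g a).
  suff -> : (1 - e) (g - a) = 0 by rewrite !mulr0.
  have ga0 : g - a < 0 by rewrite subr_lt0.
  by rewrite coef_hahnB coef_hahn1 (lt_eqF ga0) es ?subr0// (lt_trans ga0).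
rewrite mulrC -opprB mulNr -subrX1 opprB coef_hahnB.
by rewrite (hlowX es (sN g)) subr0.
Qed.

Fact hahn_unit x : x != 0 -> exists y, y * x = 1.
Proof.
move=> x0; have [||m xm minm] := @hahn_minima x (hsupp x) => //.
  apply/set0P; apply: contra_neq x0 => sx0; apply: hahnP => g.
  apply/eqP; rewrite coef_hahn0; apply: contraT => xg.
  by have : hsupp x g by []; rewrite sx0.
pose u := hmonomial (x m)^-1 (- m); pose e := 1 - u * x.
have uxE g : (u * x) g = (x m)^-1 * x (g + m).
  by rewrite [LHS]hmonomialM opprK.
have e_le0 g : g <= 0 -> e g = 0.
  rewrite le_eqVlt /e coef_hahnB coef_hahn1 uxE => /predU1P[->|g0].
    by rewrite eqxx add0r mulVf ?subrr.
  have -> : x (g + m) = 0.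
    apply/eqP; apply: contraTT g0 => /minm.
    by rewrite -leNgt -{1}[m]add0r lerD2r.
  by rewrite (lt_eqF g0) mulr0 subr0.
have [s s0 es] : exists2 s, 0 < s & hlow e s.
  have [e0|/set0P e0] := eqVneq (hsupp e) set0.
    exists 1 => // g _; apply/eqP; apply: contraT => eg.
    by have : hsupp e g by []; rewrite e0.
  have [//|s es mins] := @hahn_minima e (hsupp e) _ e0.
  exists s; first by rewrite ltNge; apply: contra es => /e_le0->.
  by move=> g gs; apply/eqP; apply: contraTT gs => /mins; rewrite leNgt.
have [y] := hlow_sub_inv s0 es; rewrite /e opprB addrCA subrr addr0 mulrA => yu.
by exists (y * u).
Qed.

Definition hinv x : hahn := xget 0 [set y | y * x = 1].

Fact hmulV x : x != 0 -> hinv x * x = 1.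
Proof. by move=> /hahn_unit[y yx]; rewrite /hinv; case: xgetP => [_ ->|/(_ y)]. Qed.

Fact hinv0 : hinv 0 = 0.
Proof.
rewrite /hinv; case: xgetP => // y _ /= /eqP.
by rewrite mulr0 eq_sym oner_eq0.
Qed.

HB.instance Definition _ := GRing.ComNzRing_isField.Build hahn hmulV hinv0.

Definition hahn_integral : pred hahn :=
  fun x => `[< {subset support x <= `[0%R, +oo[ } >].

Lemma hahn_integralP x : reflect (hlow x 0) (hahn_integral x).
Proof.
apply: (iffP (asboolP _)) => [xs g g0|x0 g].
  apply/eqP; apply: contraLR g0 => xg.
  by have := xs g xg; rewrite in_itv/= andbT -leNgt.
by rewrite in_itv/= andbT leNgt; apply: contra => /x0/eqP.
Qed.

Fact hahn_integral_subring : subring_closed hahn_integral.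
Proof.
split=> [|x y /hahn_integralP x0 /hahn_integralP y0|x y].
- by apply/hahn_integralP => g g0; rewrite coef_hahn1 lt_eqF.
- by apply/hahn_integralP => g g0; rewrite coef_hahnB x0// y0// subrr.
move=> /hahn_integralP x0 /hahn_integralP y0.
by apply/hahn_integralP; rewrite -[0]addr0; apply: hlowM.
Qed.
HB.instance Definition _ :=
  GRing.isSubringClosed.Build hahn hahn_integral hahn_integral_subring.

(* The valuation ring V_H of the Hahn field. *)
Record hahn_valring := HahnValring { hval :> hahn; _ : hahn_integral hval }.

HB.instance Definition _ := [isSub for hval].
HB.instance Definition _ := [Choice of hahn_valring by <:].
HB.instance Definition _ := [SubChoice_isSubComNzRing of hahn_valring by <:].

End Hahn.

(* Main.v *)
(* Let V be the valuation ring of the Hahn field K and A = V[[T]]. For a      *)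
(* column s over A with syzygy module M, the values u_j(0) of those u in M    *)
(* with u_i(0) = 0 for all i < j form a principal ideal of V, although the    *)
(* open ideals of V are not finitely generated. Indeed let d be the infimum   *)
(* of the valuations of these u_j(0). Modulo the finitely supported linear    *)
(* relations satisfied by all these u, the form sending the functional        *)
(* u |-> u_j(0) to t^d has norm at most 1; as K is spherically complete, it   *)
(* extends with norm at most 1 to all finitely supported functionals          *)
(* (ultrametric Hahn-Banach), that is, to a syzygy whose j-th entry starts    *)
(* with t^d. Lifting T-adically, M is spanned by n rows in triangular form,   *)
(* so A is coherent. For s = (f, g) at most one row is nonzero, and the       *)
(* quotient of g by its first entry is a gcd of f and g.                      *)

Require Import Defs.
From mathcomp Require Import all_boot all_order all_algebra.
From mathcomp Require Import all_classical all_reals Rstruct ring.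

Set Implicit Arguments.
Unset Strict Implicit.
Unset Printing Implicit Defensive.

Import Order.TTheory GRing.Theory Num.Theory.
Local Open Scope classical_set_scope.
Local Open Scope ring_scope.

(** Coherence and gcds both reduce to [valring_pivots]: the syzygies of a column over V[[T]] contain
    rows, triangular modulo T, whose pivots divide all competing constant terms. A priori the
    infimum d of the valuations of these terms is not attained. But being a syzygy is a family of
    finite linear relations on coefficients, and [annihilator_pivot] solves all of them with value
    t^d at the pivot, by [hahn_spherically_complete] and a Hahn-Banach extension. [syzygy_span]
    turns the pivot rows into generators, whence [pivots_coherent] and [pivots_gcd]. Density of the
    value group gives [valring_not_noetherian]. *)

(** * Valuations and spherical completeness of the Hahn field *)

Section HahnValuation.
Variables (R : realType) (kappa : fieldType).
Local Notation K := (hahn R kappa).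
Implicit Types (x y z : K) (m r s : R).

Definition has_val x m := x m != 0 /\ hlow x m.

Lemma has_val_ex x : x != 0 -> exists m, has_val x m.
Proof.
move=> x0; have [||m xm minm] := @hahn_minima _ _ x (hsupp x) => //.
  apply/set0P; apply: contra_neq x0 => sx0; apply: hahnP => g.
  apply/eqP; rewrite coef_hahn0; apply: contraT => xg.
  by have : hsupp x g by []; rewrite sx0.
exists m; split=> // g gm; apply/eqP; apply: contraTT gm => /minm.
by rewrite leNgt.
Qed.

Lemma has_valM x y m r : has_val x m -> has_val y r -> has_val (x * y) (m + r).
Proof.
move=> [xm lx] [yr ly]; split; last exact: hlowM.
rewrite coef_hahnM (@hconv_supp _ _ _ _ _ [set m]).
  by rewrite fsbig_set1 addrC addKr mulf_neq0.
move=> a xa ya; apply/eqP; rewrite eq_le !leNgt; apply/andP; split.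
  by apply: contra ya => ma; rewrite ly// ltrBlDl ltrD2r.
by apply: contra xa => /lx ->.
Qed.

Lemma has_val_monomial r : has_val (hmonomial 1 r : K) r.
Proof.
split=> [|g gr]; rewrite /= /monomial_fun ?eqxx ?oner_eq0//.
by rewrite (lt_eqF gr).
Qed.

Lemma has_val_neq0 x m : has_val x m -> x != 0.
Proof. by case=> xm _; apply: contraNneq xm => ->. Qed.

Lemma hlow_le r s x : r <= s -> hlow x s -> hlow x r.
Proof. by move=> rs xs g gr; apply: xs; apply: lt_le_trans rs. Qed.

Lemma hlow0 r : hlow (0 : K) r.
Proof. by []. Qed.

Lemma hlowD x y r : hlow x r -> hlow y r -> hlow (x + y) r.
Proof. by move=> xr yr g gr; rewrite coef_hahnD xr// yr// addr0. Qed.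

Lemma hlowB x y r : hlow x r -> hlow y r -> hlow (x - y) r.
Proof. by move=> xr yr g gr; rewrite coef_hahnB xr// yr// subrr. Qed.

Lemma hlow_all0 x : (forall r, hlow x r) -> x = 0.
Proof. by move=> xr; apply: hahnP => g; apply: (xr (g + 1)); rewrite ltrDl. Qed.

Lemma hlow_cancel x z m r : has_val x m -> hlow (z * x) r -> hlow z (r - m).
Proof.
have [->|/has_val_ex[l vz]] := eqVneq z 0; first by move=> _ _; exact: hlow0.
move=> vx zxr; have [zxn0 _] := has_valM vz vx.
case: vz => _; apply: hlow_le; rewrite lerBlDr leNgt.
by apply: contra zxn0 => /zxr->.
Qed.

(* The common point takes its coefficient at g from any ball of radius > g. *)
Lemma hahn_spherically_complete (B : set (K * R)) :
    (forall b b', B b -> B b' -> hlow (b.1 - b'.1) (Num.min b.2 b'.2)) ->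
  exists x, forall b, B b -> hlow (x - b.1) b.2.
Proof.
move=> Bc; pose c g := (xget (0 : K, 0 : R) [set b | B b /\ g < b.2]).1 g.
have cE b g : B b -> g < b.2 -> c g = b.1 g.
  move=> Bb gb; rewrite /c; set b' := xget _ _.
  have [Bb' gb'] : [set b | B b /\ g < b.2] b' by apply: xgetPex; exists b.
  have := Bc b' b Bb' Bb g; rewrite lt_min gb' gb coef_hahnB => /(_ isT) /eqP.
  by rewrite subr_eq0 => /eqP.
have cP : well_supported c.
  (* Up to g, the function c agrees with the center of one ball of radius > g, whose support is
     well-ordered. *)
  apply/well_supportedP => A Ac [g Ag].
  have [b [Bb gb]] : exists b, B b /\ g < b.2.
    have := Ac _ Ag; rewrite /hsupp /= /c.
    by case: xgetP => [b _ Pb _|_]; [exists b|rewrite eqxx].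
  have [||m [Am mg] minm] := @hahn_minima _ _ b.1 (A `&` [set a | a <= g]).
  - by move=> a [/Ac + /= ag]; rewrite /hsupp/= (cE b)// (le_lt_trans ag).
  - by exists g; split=> /=.
  exists m => // a Aa; have [ag|/ltW ga] := leP a g; first by apply: minm.
  exact: le_trans ga.
exists (Hahn cP) => b Bb g gb.
by rewrite coef_hahnB -[Hahn cP g]/(c g) (cE b)// subrr.
Qed.

End HahnValuation.

(** * Ultrametric Hahn-Banach extension on K[X] *)

Section UltrametricHahnBanach.
Variables (R : realType) (kappa : fieldType).
Local Notation K := (hahn R kappa).
Implicit Types (G : set ({poly K} * K)) (e y : {poly K}) (a b : K).

Definition plow y (r : R) := forall i, hlow y`_i r.

(* The graph of a linear form of norm at most 1, for the Gauss norm, on a    *)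
(* subspace of K[X]; functionality follows from the third condition at y = 0. *)
Definition contraction G :=
  [/\ G (0, 0),
      forall a p q, G p -> G q -> G (a *: p.1 + q.1, a * p.2 + q.2) &
      forall p r, G p -> plow p.1 r -> hlow p.2 r].

Definition extend_graph G e b : set ({poly K} * K) :=
  [set p | exists a q, G q /\ p = (q.1 + a *: e, q.2 + a * b)].

Lemma contractionB G p q : contraction G -> G p -> G q -> G (q.1 - p.1, q.2 - p.2).
Proof.
move=> [_ + _] Gp Gq => /(_ (-1) p q Gp Gq).
by rewrite scaleN1r mulN1r ![_ + (_ : _ * _).1]addrC ![_ + (_ : _ * _).2]addrC.
Qed.

Lemma contraction_fun G y b b' :
  contraction G -> G (y, b) -> G (y, b') -> b = b'.
Proof.
move=> cG Gb Gb'; have /= := contractionB cG Gb Gb'; rewrite subrr => G0.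
apply/esym/eqP; rewrite -subr_eq0; apply/eqP; apply: hlow_all0 => r.
case: cG => _ _ /(_ _ r G0); apply=> i /=.
by rewrite coef0.
Qed.

(** The value b at e must lie in the ball around -G(p) of radius v(e + p), for every p in the
    domain. Two such balls meet because G contracts the difference (e + q) - (e + p), so spherical
    completeness provides b. If e is already in the domain, the balls at p = -e force b = G(e). *)
Lemma contraction_extend G e :
  contraction G -> exists b, contraction (extend_graph G e b).
Proof.
move=> cG; have [G0 lG bG] := cG.
pose B : set (K * R) :=
  [set c | exists p, [/\ G p, c.1 = - p.2 & plow (e + p.1) c.2]].
have [|b Bb] := @hahn_spherically_complete _ _ B.
  move=> b c [p [Gp -> ep]] [q [Gq -> eq]].
  rewrite opprK addrC; apply: (bG (q.1 - p.1, q.2 - p.2)); first exact: contractionB.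
  have -> : q.1 - p.1 = (e + q.1) - (e + p.1) by rewrite opprD addrACA subrr add0r.
  move=> i /=; rewrite coefB; apply: hlowB.
    by apply: hlow_le (eq i); rewrite ge_min lexx orbT.
  by apply: hlow_le (ep i); rewrite ge_min lexx.
exists b; split.
- by exists 0, (0, 0); split=> //; rewrite !mul0r !scale0r !addr0.
- move=> a _ _ [c [p [Gp ->]]] [d [q [Gq ->]]].
  exists (a * c + d), (a *: p.1 + q.1, a * p.2 + q.2); split; first exact: lG.
  congr (_, _) => /=; last by rewrite mulrDl mulrDr mulrA addrACA.
  by rewrite scalerDr scalerDl scalerA addrACA.
move=> _ r [a [p [Gp ->]]] /=.
have [->|a0] := eqVneq a 0; first by rewrite scale0r mul0r !addr0; apply: bG.
(* Dividing by a reduces to the case a = 1, for which b was chosen. *)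
move=> ppr; have [m va] := has_val_ex a0.
have aG : G (a^-1 *: p.1, a^-1 * p.2).
  by have := lG a^-1 _ _ Gp G0; rewrite !addr0.
have : hlow (b - - (a^-1 * p.2)) (r - m).
  apply: (Bb (- (a^-1 * p.2), r - m)).
  exists (a^-1 *: p.1, a^-1 * p.2); split=> // i /=.
  apply: (hlow_cancel va).
  have := ppr i; rewrite !coefD !coefZ mulrDl [_^-1 * _]mulrC mulfVK//.
  by rewrite addrC mulrC.
rewrite opprK => /(hlowM (proj2 va)); rewrite mulrDr mulVKf// subrKC.
by rewrite addrC.
Qed.

(** The basis of K[X] is countable, so adjoining the monomials one at a time replaces Zorn's lemma.
    From a contraction G, the [xget] never falls back on its default, by [contraction_extend]. *)
Fixpoint graph_tower G n :=
  if n is n.+1 then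
    let H := graph_tower G n in
    extend_graph H 'X^n (xget 0 [set b | contraction (extend_graph H 'X^n b)])
  else G.

Lemma contraction_tower G n : contraction G -> contraction (graph_tower G n).
Proof.
move=> cG; elim: n => //= n /(@contraction_extend _ 'X^n)[b cb].
by case: xgetP => [//|/(_ b)].
Qed.

Lemma sub_extend_graph G e b : G `<=` extend_graph G e b.
Proof.
by move=> [y c] Gy; exists 0, (y, c); split=> //; rewrite scale0r mul0r !addr0.
Qed.

Lemma sub_graph_tower G m n :
  (m <= n)%N -> graph_tower G m `<=` graph_tower G n.
Proof.
move=> /subnKC <-; elim: (n - m)%N => [|k IH]; first by rewrite addn0.
by rewrite addnS; apply: subset_trans IH _; apply: sub_extend_graph.
Qed.

Lemma contraction_total G : contraction G ->
  exists2 H, contraction H & G `<=` H /\ forall i, exists b, H ('X^i, b).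
Proof.
move=> cG; exists (\bigcup_n graph_tower G n); last first.
  split=> [p Gp|i]; first by exists 0%N.
  eexists; exists i.+1 => //=; exists 1, (0, 0); split; last first.
    by rewrite scale1r mul1r !add0r; reflexivity.
  by have [] := contraction_tower i cG.
split.
- by exists 0%N => //; case: cG.
- move=> a p q [m _ Gp] [n _ Gq]; exists (maxn m n) => //.
  have [_ + _] := contraction_tower (maxn m n) cG; apply.
    by apply: sub_graph_tower Gp; rewrite leq_maxl.
  by apply: sub_graph_tower Gq; rewrite leq_maxr.
by move=> p r [n _ Gp]; have [_ _] := contraction_tower n cG; apply.
Qed.

(** Polynomials stand for finitely supported functionals on sequences, 'X^i being the i-th
    coordinate. *)
Definition pair (x : nat -> K) y := \sum_(i < size y) y`_i * x i.

Lemma pairE n x y : (size y <= n)%N -> pair x y = \sum_(i < n) y`_i * x i.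
Proof.
move=> yn; rewrite /pair (big_ord_widen n (fun i => y`_i * x i))//.
rewrite big_mkcond; apply: eq_bigr => i _.
by case: ltnP => // iy; rewrite nth_default ?mul0r.
Qed.

Lemma pair_linear x a y z : pair x (a *: y + z) = a * pair x y + pair x z.
Proof.
pose n := maxn (size (a *: y + z)) (maxn (size y) (size z)).
rewrite !(@pairE n) ?leq_max ?leqnn ?orbT// mulr_sumr -big_split.
by apply: eq_bigr => i _; rewrite coefD coefZ mulrDl mulrA.
Qed.

Lemma pair0 x : pair x 0 = 0.
Proof. by rewrite /pair size_poly0 big_ord0. Qed.

Lemma pairXn x n : pair x 'X^n = x n.
Proof.
rewrite (@pairE n.+1) ?size_polyXn// (bigD1 ord_max)//= coefXn eqxx mul1r.
by rewrite big1 ?addr0// => i /negPf; rewrite coefXn -val_eqE /= => ->; rewrite mul0r.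
Qed.

Lemma pairZ x a y : pair x (a *: y) = a * pair x y.
Proof. by rewrite -[a *: y]addr0 pair_linear pair0 addr0. Qed.

Lemma pair_sum x (I : Type) (s : seq I) (f : I -> {poly K}) :
  pair x (\sum_(i <- s) f i) = \sum_(i <- s) pair x (f i).
Proof.
have pairD y z : pair x (y + z) = pair x y + pair x z.
  by rewrite -[y]scale1r pair_linear mul1r scale1r.
exact: (big_morph _ pairD (pair0 x)).
Qed.

Lemma contraction_pair G x y :
  contraction G -> (forall i, G ('X^i, x i)) -> G (y, pair x y).
Proof.
move=> [G0 lG _] Gx; rewrite -{1}[y]coefK poly_def /pair.
elim/big_ind2: _ => [|y1 b1 y2 b2 G1 G2|i _] //.
  by have := lG 1 _ _ G1 G2; rewrite scale1r mul1r.
by have := lG y`_i _ _ (Gx i) G0; rewrite !addr0.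
Qed.

(* The form a e_j |-> a t^d, with d the infimum of the v(u_j), is of norm at *)
(* most 1 modulo the common annihilator of M, hence extends to all of K[X].  *)
Lemma annihilator_pivot (M : set (nat -> K)) (j : nat) :
    (forall u i, M u -> hlow (u i) 0) -> (exists2 u, M u & u j != 0) ->
  exists x : nat -> K, [/\ forall i, hlow (x i) 0,
    forall y, (forall u, M u -> pair u y = 0) -> pair x y = 0 &
    exists2 d, has_val (x j) d & forall u, M u -> hlow (u j) d].
Proof.
move=> M0 [u0 Mu0 u0j].
pose S := [set m | exists2 u, M u & has_val (u j) m].
have S0 : S !=set0 by have [m vm] := has_val_ex u0j; exists m, u0.
have lbS : lbound S 0.
  move=> m [u Mu [um _]]; rewrite leNgt; apply: contra um.
  by move=> m0; rewrite M0.
have infS : has_inf S by split=> //; exists 0.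
set d := inf S in infS.
have ud u : M u -> hlow (u j) d.
  move=> Mu; have [->|/has_val_ex[m vm]] := eqVneq (u j) 0; first exact: hlow0.
  by case: (vm) => _; apply: hlow_le; apply: ge_inf; [exists 0|exists u].
(* The domain consists of the functionals that agree on M with some multiple a of the j-th
   coordinate. *)
pose G : set ({poly K} * K) := [set p | exists2 a, p.2 = a * hmonomial 1 d &
  forall u, M u -> pair u p.1 = a * u j].
have cG : contraction G.
  split=> /=.
  - by exists 0 => [|u Mu]; rewrite ?pair0 mul0r.
  - move=> a p q [b pb Gp] [c qc Gq]; exists (a * b + c) => [|u Mu].
      by rewrite pb qc mulrDl mulrA.
    by rewrite pair_linear Gp// Gq// mulrDl mulrA.
  move=> p r [a -> Gp] pr.
  have aur u : M u -> hlow (a * u j) r.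
    move=> Mu; rewrite -Gp// /pair; elim/big_ind: _ => [|x y|i _].
    - exact: hlow0.
    - exact: hlowD.
    by rewrite -[r]addr0; apply: hlowM => //; apply: M0.
  have [->|/has_val_ex[l va]] := eqVneq a 0; first by rewrite mul0r; apply: hlow0.
  (* Since v(a u_j) >= r for all u in M, r - v(a) is a lower bound of S. *)
  have rld : r - l <= d.
    apply: lb_le_inf => // m [u Mu vu]; rewrite lerBlDl leNgt.
    by have [+ _] := has_valM va vu; apply: contra => /(aur _ Mu)->.
  apply: (@hlow_le _ _ _ (l + d)); first by rewrite -lerBlDl.
  by apply: hlowM; [case: va|case: (has_val_monomial kappa d)].
have [H cH [GH /choice[x Hx]]] := contraction_total cG.
have HG y b : G (y, b) -> pair x y = b.
  move=> /GH; apply: (contraction_fun cH); exact: contraction_pair.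
exists x; split.
- move=> i; have [_ _ /(_ _ 0 (Hx i))] := cH; apply=> k; rewrite coefXn.
  by case: (k == i); [exact: (proj2 (has_val_monomial kappa 0))|exact: hlow0].
(* A functional killing M lies in the domain of G with a = 0. *)
- by move=> y yM; apply: HG; exists 0 => [|u Mu] /=; rewrite mul0r// yM.
exists d => //; rewrite -(pairXn x) (HG _ (hmonomial 1 d)).
  exact: has_val_monomial.
by exists 1 => [|u Mu] /=; rewrite mul1r// pairXn.
Qed.

End UltrametricHahnBanach.

(** * Syzygies over power series rings *)

Section PowerSeries.
Variable V : comNzRingType.
Local Notation A := (powser V).
Implicit Types (a b : A) (c : V).

Lemma coef_psB a b n : (a - b) n = a n - b n.
Proof. by []. Qed.

Lemma coef_psM a b n : (a * b) n = \sum_(i < n.+1) a i * b (n - i)%N.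
Proof. by []. Qed.

Lemma coef_ps_sum (I : Type) (r : seq I) (P : pred I) (F : I -> A) n :
  (\sum_(i <- r | P i) F i) n = \sum_(i <- r | P i) F i n.
Proof. by apply: (big_morph (fun a : A => a n)). Qed.

Definition psC c : A := PowSer (fun n => if n == 0%N then c else 0).
Definition psshift a : A := PowSer (fun n => a n.+1).

Lemma coef_psCM c a n : (psC c * a) n = c * a n.
Proof.
rewrite coef_psM big_ord_recl /= subn0 big1 ?addr0// => i _.
by rewrite mul0r.
Qed.

Lemma coef_psM0 a b : (a * b) 0%N = a 0%N * b 0%N.
Proof. by rewrite coef_psM big_ord_recl big_ord0 addr0. Qed.

Lemma coef_psMS a b n : (a * b) n.+1 = a 0%N * b n.+1 + (psshift a * b) n.
Proof. by rewrite !coef_psM big_ord_recl. Qed.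

Lemma ps_neq0 a : a != 0 -> exists n, a n != 0 /\ forall i, (i < n)%N -> a i = 0.
Proof.
move=> a0; have ex : exists n, a n != 0.
  have [//|nex] := pselect (exists n, a n != 0).
  case/eqP: a0; apply: powserP => n; apply/eqP.
  by apply: contra_notT nex => an; exists n.
case: (ex_minnP ex) => n an minn; exists n; split=> // i; apply: contraTeq => /minn.
by rewrite leqNgt.
Qed.

Lemma powser_domain :
  GRing.integral_domain_axiom V -> GRing.integral_domain_axiom A.
Proof.
move=> domV a b ab0; apply/norP => -[/ps_neq0[m [am ma]] /ps_neq0[n [bn nb]]].
have : (a * b) (m + n)%N = a m * b n.
  have mP : (m < (m + n).+1)%N by rewrite ltnS leq_addr.
  rewrite coef_psM (bigD1 (Ordinal mP))//= addKn big1 ?addr0// => i.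
  rewrite -val_eqE neq_ltn => /orP[/ma->|/= mi]; first by rewrite mul0r.
  by rewrite nb ?mulr0// ltn_subLR ?ltn_add2r// -ltnS.
rewrite ab0 => /esym/domV; by rewrite (negPf am) (negPf bn).
Qed.

(* The last clause makes a zero pivot mean that all the u 0 j 0 vanish. *)
Definition syzygy_pivot n (s : 'cV[A]_n) (j : 'I_n) (w : 'rV[A]_n) :=
  [/\ w *m s = 0, forall i : 'I_n, (i < j)%N -> w 0 i 0%N = 0,
      w 0 j 0%N = 0 -> w = 0 &
      forall u : 'rV[A]_n, u *m s = 0 ->
        (forall i : 'I_n, (i < j)%N -> u 0 i 0%N = 0) ->
        divides (w 0 j 0%N) (u 0 j 0%N)].

Definition has_syzygy_pivots :=
  forall n (s : 'cV[A]_n) j, exists w, syzygy_pivot s j w.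

Section Syzygies.
Variables (n : nat) (s : 'cV[A]_n) (k : 'M[A]_n).
Hypothesis k_pivot : forall j, syzygy_pivot s j (row j k).
Implicit Types u d : 'rV[A]_n.

Lemma syzygy_rows : k *m s = 0.
Proof. by apply/row_matrixP => j; rewrite row_mul row0; case: (k_pivot j). Qed.

Lemma coef_sub_mulmxC u (c : 'rV[V]_n) i p :
  (u - map_mx psC c *m k) 0 i p = u 0 i p - \sum_j c 0 j * k j i p.
Proof.
rewrite !mxE coef_psB coef_ps_sum; congr (_ - _).
by apply: eq_bigr => j _; rewrite mxE coef_psCM.
Qed.

(** Gaussian elimination modulo T: row j of [k] clears the constant term of column j and leaves the
    earlier columns clear. *)
Lemma syzygy_const u : u *m s = 0 ->
  exists c : 'rV[V]_n, forall i, (u - map_mx psC c *m k) 0 i 0%N = 0.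
Proof.
move=> us; suff /(_ n (leqnn n))[c cP] : forall m, (m <= n)%N ->
    exists c : 'rV[V]_n, forall i : 'I_n, (i < m)%N ->
      (u - map_mx psC c *m k) 0 i 0%N = 0.
  by exists c => i; apply: cP.
elim=> [|m IH mn]; first by exists 0.
have [c cP] := IH (ltnW mn); pose j := Ordinal mn.
have [_ kj0 _ kj] := k_pivot j.
have [||b bE] := kj (u - map_mx psC c *m k).
- by rewrite mulmxBl us -mulmxA syzygy_rows mulmx0 subrr.
- by move=> i ij; apply: cP.
exists (c + b *: delta_mx 0 j) => i.
have -> : (u - map_mx psC (c + b *: delta_mx 0 j) *m k) 0 i 0%N =
          (u - map_mx psC c *m k) 0 i 0%N - b * k j i 0%N.
  rewrite !coef_sub_mulmxC -addrA -opprD; congr (_ - _).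
  under eq_bigr do rewrite !mxE eqxx /= mulrDl.
  rewrite big_split /=; congr (_ + _).
  rewrite (bigD1 j)//= eqxx mulr1 big1 ?addr0// => l.
  by move=> /negPf ->; rewrite mulr0 mul0r.
rewrite ltnS leq_eqVlt => /predU1P[im|im]; last first.
  have := kj0 i im; rewrite mxE => ->.
  by rewrite mulr0 subr0; apply: cP.
have -> : i = j by apply: val_inj.
by rewrite bE mxE subrr.
Qed.

Lemma syzygy_shift u : u *m s = 0 -> (forall i, u 0 i 0%N = 0) ->
  map_mx psshift u *m s = 0.
Proof.
move=> us u0; apply/rowP => i; rewrite ord1; apply: powserP => p.
transitivity ((u *m s) 0 0 p.+1); last by rewrite us !mxE.
rewrite !mxE !coef_ps_sum; apply: eq_bigr => l _.
by rewrite coef_psMS u0 mul0r add0r mxE.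
Qed.

(** T-adic lifting: u = c_0 k + T u_1 with u_1 again a syzygy, u_1 = c_1 k + T u_2, and so on; then
    d is the sum of the c_p T^p. *)
Lemma syzygy_span u : u *m s = 0 -> exists d, u = d *m k.
Proof.
(* A choice defined on all rows, syzygies or not, makes [next] a function that can be iterated. *)
have /choice[c cP] : forall u, exists c : 'rV[V]_n, u *m s = 0 ->
    forall i, (u - map_mx psC c *m k) 0 i 0%N = 0.
  move=> v; have [/syzygy_const[c cP]|nv] := eqVneq (v *m s) 0; first by exists c.
  by exists 0 => /eqP; rewrite (negPf nv).
pose next u := map_mx psshift (u - map_mx psC (c u) *m k).
have nextP v : v *m s = 0 -> next v *m s = 0.
  move=> vs; apply: syzygy_shift; last exact: cP.
  by rewrite mulmxBl vs -mulmxA syzygy_rows mulmx0 subrr.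
pose d u : 'rV[A]_n := \row_j PowSer (fun p => c (iter p next u) 0 j).
have dS v j : psshift (d v 0 j) = d (next v) 0 j.
  by apply: powserP => p; rewrite !mxE /= -iterSr.
move=> us; exists (d u); apply/rowP => i; apply: powserP => p.
elim: p u us => [|p IH] u us; rewrite mxE coef_ps_sum.
  move/eqP: (cP u us i); rewrite coef_sub_mulmxC subr_eq0 => /eqP ->.
  by apply: eq_bigr => j _; rewrite coef_psM0 mxE.
under eq_bigr do rewrite coef_psMS dS.
rewrite big_split /=.
have := IH _ (nextP _ us); rewrite [in X in _ = X -> _]mxE coef_ps_sum => <-.
rewrite mxE [psshift _ p]coef_sub_mulmxC.
under eq_bigr do rewrite mxE.
by rewrite subrKC.
Qed.

End Syzygies.

Lemma syzygy_matrix n (s : 'cV[A]_n) : has_syzygy_pivots ->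
  exists k : 'M[A]_n, forall j, syzygy_pivot s j (row j k).
Proof.
move=> /(_ n s)/choice[w wP]; exists (\matrix_j w j) => j.
by rewrite rowK.
Qed.

Lemma pivots_coherent : has_syzygy_pivots -> coherent A.
Proof.
move=> pV _ [n [s ->]]; exists n, s; split=> //.
have [k kP] := syzygy_matrix s pV; exists n, k; apply/seteqP; split=> c /=.
  by case/(syzygy_span kP) => d ->; exists d.
by case=> d _ <-; rewrite -mulmxA (syzygy_rows kP) mulmx0.
Qed.

(** The syzygies of (f, g) are the multiples of one row (w0, w1), and (g, -f) = h (w0, w1) defines
    the gcd h. A common divisor e yields the syzygy (g/e, -f/e), again a multiple h' (w0, w1);
    cancelling w0 gives h = h' e. *)
Lemma pivots_gcd : GRing.integral_domain_axiom V -> has_syzygy_pivots ->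
  gcd_domain A.
Proof.
move=> domV pV; have domA := powser_domain domV; split=> // f g f0 g0.
pose s : 'cV[A]_2 := \col_i (if i == 0 then f else g).
pose i0 : 'I_2 := ord0; pose i1 : 'I_2 := lift ord0 ord0.
pose v a b : 'rV[A]_2 := \row_i (if i == 0 then a else b).
have usE m (u : 'M[A]_(m, 2)) i : (u *m s) i 0 = u i i0 * f + u i i1 * g.
  by rewrite mxE big_ord_recl big_ord1 !mxE.
have [k kP] := syzygy_matrix s pV.
have kE i : k i i0 * f + k i i1 * g = 0.
  by have [/matrixP/(_ 0 0)] := kP i; rewrite usE !mxE.
have spanE a b : a * f + b * g = 0 -> exists c d : A,
    a = c * k i0 i0 + d * k i1 i0 /\ b = c * k i0 i1 + d * k i1 i1.
  move=> abE; have [|d dE] := @syzygy_span _ _ _ kP (v a b).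
    by apply/rowP => i; rewrite ord1 usE !mxE.
  exists (d 0 i0), (d 0 i1).
  have dkE i : v a b 0 i = d 0 i0 * k i0 i + d 0 i1 * k i1 i.
    by rewrite dE mxE big_ord_recl big_ord1.
  by rewrite -!dkE !mxE.
(* By the determinant one of the two pivots vanishes, so a single row is left. *)
have [w0 [w1 [wE wP]]] : exists w0 w1 : A, w0 * f + w1 * g = 0 /\
    forall a b, a * f + b * g = 0 -> exists c : A, a = c * w0 /\ b = c * w1.
  have nz (a b c d : A) : a * f + b * g = 0 -> c * f + d * g = 0 -> a * d = b * c.
    move=> abE cdE; apply/eqP; rewrite -subr_eq0.
    suff : (a * d - b * c) * f = 0 by move=> /domA; rewrite (negPf f0) orbF.
    transitivity (d * (a * f + b * g) - b * (c * f + d * g)); last first.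
      by rewrite abE cdE !mulr0 subrr.
    by ring.
  have [k0|k00] := eqVneq (row i0 k) 0.
    exists (k i1 i0), (k i1 i1); split=> // a b /spanE[c [d [-> ->]]].
    exists d; move/rowP: k0 => k0; have := k0 i0; have := k0 i1.
    by rewrite !mxE => -> ->; rewrite !mulr0 !add0r.
  have [k1|k10] := eqVneq (row i1 k) 0.
    exists (k i0 i0), (k i0 i1); split=> // a b /spanE[c [d [-> ->]]].
    exists c; move/rowP: k1 => k1; have := k1 i0; have := k1 i1.
    by rewrite !mxE => -> ->; rewrite !mulr0 !addr0.
  have p0 : k i0 i0 0%N != 0.
    by apply: contra_neq k00 => k0; case: (kP i0) => _ _ + _; rewrite mxE; apply.
  have p1 : k i1 i1 0%N != 0.
    by apply: contra_neq k10 => k0; case: (kP i1) => _ _ + _; rewrite mxE; apply.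
  have z : k i1 i0 0%N = 0 by case: (kP i1) => _ /(_ i0 isT); rewrite mxE.
  have := congr1 (fun a : A => a 0%N) (nz _ _ _ _ (kE i0) (kE i1)).
  rewrite !coef_psM0 z mulr0 => /domV.
  by rewrite (negPf p0) (negPf p1).
have [|h [gE fE]] := wP g (- f); first by rewrite mulNr [g * f]mulrC subrr.
have w00 : w0 != 0 by apply: contra_neq g0 => w00; rewrite gE w00 mulr0.
exists h; split.
- by exists (- w1); rewrite mulNr mulrC -fE opprK.
- by exists w0; rewrite mulrC.
move=> e [f' f'E] [g' g'E].
have [|h' [g'h _]] := wP g' (- f').
  have [e0|e0] := eqVneq e 0; first by case/eqP: f0; rewrite f'E e0 mulr0.
  have /domA : e * (g' * f + - f' * g) = 0 by rewrite f'E g'E; ring.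
  by rewrite (negPf e0) => /eqP.
exists h'; apply/eqP; rewrite -subr_eq0.
have /domA : (h - h' * e) * w0 = 0 by rewrite mulrBl -gE mulrAC -g'h -g'E subrr.
by rewrite (negPf w00) orbF.
Qed.

End PowerSeries.

(** * The valuation ring of the Hahn field *)

Section HahnValuationRing.
Variables (R : realType) (kappa : fieldType).
Local Notation K := (hahn R kappa).
Local Notation V := (hahn_valring R kappa).
Local Notation A := (powser V).
Implicit Types a b : V.

Lemma hval_low a : hlow (hval a) 0.
Proof. by apply/hahn_integralP/(valP a). Qed.

Lemma hvalM a b : hval (a * b) = hval a * hval b.
Proof. by []. Qed.

Lemma hval_sum (I : Type) (r : seq I) (P : pred I) (F : I -> V) :
  hval (\sum_(i <- r | P i) F i) = \sum_(i <- r | P i) hval (F i).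
Proof. exact: (raddf_sum (val : V -> K)). Qed.

Lemma valring_divides a b m : has_val (hval a) m -> hlow (hval b) m -> divides a b.
Proof.
move=> va bm; have a0 := has_val_neq0 va.
have c0 : hahn_integral (hval b / hval a).
  apply/hahn_integralP; rewrite -(subrr m); apply: (hlow_cancel va).
  by rewrite divfK.
by exists (HahnValring c0); apply: val_inj; rewrite [RHS]divfK.
Qed.

Lemma valring_domain : GRing.integral_domain_axiom V.
Proof.
move=> a b /(congr1 (@hval R kappa)); rewrite hvalM => /eqP.
by rewrite mulf_eq0 => /orP[] /eqP ab0; apply/orP; [left|right];
  apply/eqP/val_inj.
Qed.

Lemma valring_valuation : valuation_domain V.
Proof.
split=> [|a b]; first exact: valring_domain.
have [a0|/has_val_ex[m va]] := eqVneq (hval a) 0.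
  by right; exists 0; rewrite mul0r; apply: val_inj.
have [b0|/has_val_ex[l vb]] := eqVneq (hval b) 0.
  by left; exists 0; rewrite mul0r; apply: val_inj.
have [ml|/ltW lm] := leP m l; [left|right].
  by apply: (valring_divides va); apply: (hlow_le ml); case: vb.
by apply: (valring_divides vb); apply: (hlow_le lm); case: va.
Qed.

(** Finitely many elements of the maximal ideal have valuations at least some d > 0, and so has all
    that they generate; but t^(d/2) is in the maximal ideal. *)
Lemma valring_not_noetherian : ~ noetherian V.
Proof.
pose I : set V := [set a | exists2 r, 0 < r & hlow (hval a) r].
case/(_ I) => [|n [s Is]].
  split; first by exists 1.
    move=> a b [r r0 ar] [l l0 bl]; exists (Num.min r l); first by rewrite lt_min r0.
    by apply: hlowD; [apply: hlow_le ar|apply: hlow_le bl]; rewrite ge_min lexx ?orbT.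
  move=> a b [r r0 br]; exists r => //; rewrite -[r]add0r hvalM.
  by apply: hlowM => //; apply: hval_low.
have /choice[e eP] (i : 'I_n) : exists r, 0 < r /\ hlow (hval (s i 0)) r.
  have [r r0 sr] : I (s i 0); last by exists r.
  rewrite Is; exists (delta_mx 0 i) => //.
  by rewrite -rowE mxE.
(* The default 1 keeps d positive when there are no generators. *)
pose d := \big[Num.min/1]_i e i.
have d0 : 0 < d by apply/bigmin_gtP; split=> // i _; case: (eP i).
have d20 : 0 < d / 2 by rewrite divr_gt0.
have tP : hahn_integral (hmonomial 1 (d / 2) : K).
  apply/hahn_integralP; apply: hlow_le (ltW d20) _.
  by case: (has_val_monomial kappa (d / 2)).
have : I (HahnValring tP).
  by exists (d / 2) => //; case: (has_val_monomial kappa (d / 2)).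
rewrite Is => -[c _ cE]; have [+ _] := has_val_monomial kappa (d / 2).
apply/negP/negPn/eqP; rewrite -[hmonomial _ _]/(hval (HahnValring tP)) -cE.
suff : hlow (hval ((c *m s) 0 0)) d by apply; rewrite gtr_pMr// invf_lt1 ?ltr1n.
rewrite mxE hval_sum; elim/big_ind: _ => [|x y|i _]; first exact: hlow0.
  exact: hlowD.
rewrite hvalM -[d]add0r; apply: hlowM; first exact: hval_low.
by apply: hlow_le (proj2 (eP i)); apply: bigmin_le.
Qed.

(** Lists all coefficients of a row of power series as one sequence, the form that
    [annihilator_pivot] takes; integers that code no pair get 0. *)
Definition flat n (u : 'rV[A]_n) (m : nat) : K :=
  if unpickle m is Some (i, p) then hval (u 0 i p) else 0.

Lemma flat_pickle n (u : 'rV[A]_n) i p : flat u (pickle (i, p)) = hval (u 0 i p).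
Proof. by rewrite /flat pickleK. Qed.

(** The T^p-coefficient of [u *m s], as a finitely supported functional of the coefficients of u. *)
Definition conv_relation n (s : 'cV[A]_n) (p : nat) : {poly K} :=
  \sum_(i < n) \sum_(l < p.+1)
    hval (s i 0 (p - l)%N) *: 'X^(pickle (i, l : nat)).

Lemma pair_conv_relation n (s : 'cV[A]_n) (u : 'rV[A]_n) x p :
    (forall i q, x (pickle (i, q)) = hval (u 0 i q)) ->
  pair x (conv_relation s p) = hval ((u *m s) 0 0 p).
Proof.
move=> xE; rewrite mxE coef_ps_sum hval_sum.
rewrite pair_sum; apply: eq_bigr => i _.
rewrite pair_sum coef_psM hval_sum; apply: eq_bigr => l _.
by rewrite pairZ pairXn xE hvalM mulrC.
Qed.

(** Membership in [S] is a family of finite linear relations, all inherited by the x of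
    [annihilator_pivot]; so x is again in [S], and its j-th constant term, of valuation d, divides
    all the others. *)
Lemma valring_pivots : has_syzygy_pivots V.
Proof.
move=> n s j; pose S : set 'rV[A]_n :=
  [set u | u *m s = 0 /\ forall i : 'I_n, (i < j)%N -> u 0 i 0%N = 0].
have [[u Su uj]|nex] := pselect (exists2 u, S u & u 0 j 0%N != 0); last first.
  (* All competing constant terms vanish, so the zero row serves. *)
  exists 0; split=> [|i _||u us uj]; rewrite ?mul0mx ?mxE//.
  exists 0; rewrite mul0r; apply/eqP; apply: contra_notT nex => u0.
  by exists u.
have [|| x [x0 xann [d vx ud]]] :=
    @annihilator_pivot R kappa [set flat v | v in S] (pickle (j, 0%N)).
- move=> _ i [v _ <-]; rewrite /flat; case: unpickle => [[l p]|]; last exact: hlow0.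
  exact: hval_low.
- exists (flat u); first by exists u.
  by rewrite flat_pickle; apply: contra uj => /eqP u0; apply/eqP/val_inj.
have xP i : hahn_integral (x i) by apply/hahn_integralP.
pose w : 'rV[A]_n := \row_i PowSer (fun p => HahnValring (xP (pickle (i, p)))).
have wE i p : x (pickle (i, p)) = hval (w 0 i p) by rewrite mxE.
exists w; split.
- apply/rowP => i; rewrite ord1; apply: powserP => p; apply: val_inj.
  rewrite /= -(pair_conv_relation s p wE) mxE; apply: xann => _ [v [vs _] <-].
  by rewrite (pair_conv_relation s p (flat_pickle v)) vs mxE.
- move=> i ij; apply: val_inj; rewrite /= -wE -(pairXn x).
  by apply: xann => _ [v [_ vj] <-]; rewrite pairXn flat_pickle vj.
- move=> wj; have := has_val_neq0 vx.
  by rewrite wE wj eqxx.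
move=> v vs vj; apply: (@valring_divides _ _ d); first by rewrite -wE.
by rewrite -flat_pickle; apply: ud; exists v.
Qed.

End HahnValuationRing.

Theorem mainTheorem2 :
  (forall (R : realType) (kappa : fieldType),
     [/\ ~ noetherian (hahn_valring R kappa),
         coherent (powser (hahn_valring R kappa)) &
         gcd_domain (powser (hahn_valring R kappa))]) /\
  (exists V : comNzRingType,
     [/\ valuation_domain V, ~ noetherian V & gcd_domain (powser V)]).
Proof.
have hahnP (R : realType) (kappa : fieldType) :
     [/\ ~ noetherian (hahn_valring R kappa),
         coherent (powser (hahn_valring R kappa)) &
         gcd_domain (powser (hahn_valring R kappa))].
  split.
  - exact: valring_not_noetherian.
  - exact/pivots_coherent/valring_pivots.
  - by apply: pivots_gcd; [apply: valring_domain|apply: valring_pivots].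
split=> //; exists (hahn_valring Rdefinitions.R rat).
have [nV _ gV] := hahnP Rdefinitions.R rat.
by split=> //; apply: valring_valuation.
Qed.
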